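(* For any $p\in(0;1)$, the global maximum of the function $S_p$ on the segment $[0;1]$ is attained at the points $x=1/3$ and $x=2/3$ and only at these points, and its value is $$\max_{x\in[0;1]}S_p(x)=S_p(1/3)=\frac{2^p}{6^p-3^p}.$$
   Context: $T_0(x)$ denotes the distance from the real number $x$ to the nearest integer: $T_0(x)=|x-[x+1/2]|=\min_{m\in\mathbb{Z}}|x-m|$. For real $p>0$, $S_p(x)=\sum_{n=0}^{\infty}\left(\frac{T_0(2^n x)}{2^n}\right)^p$ for $x\in\mathbb{R}$ (a convergent series). *)

(* Defs.v *)
From mathcomp Require Import all_boot all_order all_algebra.
From mathcomp Require Import all_classical all_reals all_analysis.
From mathcomp Require Import lra.
Set Implicit Arguments.
Unset Strict Implicit.
Unset Printing Implicit Defensive.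
Import Order.TTheory GRing.Theory Num.Theory.
Import numFieldNormedType.Exports.
Local Open Scope classical_set_scope.
Local Open Scope ring_scope.

Definition T0 {R : realType} (x : R) : R := `|x - (Num.floor (x + 1 / 2))%:~R|.

Lemma T0_le_dist {R : realType} (x : R) (m : int) : T0 x <= `|x - m%:~R|.
Proof.
rewrite /T0; set k := Num.floor _.
have k1 : k%:~R <= x + 1 / 2 by exact: floor_le.
have k2 : x + 1 / 2 < k%:~R + 1 by rewrite -intrD1; exact: floorD1_gt.
have [->//|] := eqVneq m k.
rewrite neq_lt => /orP[mk|km].
- have : m%:~R + 1 <= k%:~R :> R by rewrite -intrD1 ler_int lezD1.
  by move=> ?; rewrite (ger0_norm (x := x - m%:~R)) ?ler_norml; lra.
- have : k%:~R + 1 <= m%:~R :> R by rewrite -intrD1 ler_int lezD1.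
  by move=> ?; rewrite (ler0_norm (x := x - m%:~R)) ?ler_norml; lra.
Qed.

Lemma T0_le1 {R : realType} (x : R) : T0 x <= 1.
Proof.
apply: le_trans (T0_le_dist x (Num.floor x)) _.
have f1 : (Num.floor x)%:~R <= x by exact: floor_le.
have f2 : x < (Num.floor x)%:~R + 1 by rewrite -intrD1; exact: floorD1_gt.
by rewrite ler_norml; lra.
Qed.

(* Where T0 vanishes the summand is 0, since [powR0 : p != 0 -> 0 `^ p = 0]. *)
Definition Sp_term {R : realType} (p x : R) : R^nat :=
  fun n => (T0 (2 ^+ n * x) / 2 ^+ n) `^ p.

Definition Sp {R : realType} (p x : R) : R := limn (series (Sp_term p x)).

(* The limit in [Sp] is the genuine sum, not a default value. *)
Lemma is_cvg_Sp {R : realType} (p x : R) : 0 < p -> cvgn (series (Sp_term p x)).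
Proof.
move=> p0; pose q : R := 2^-1 `^ p.
have q0 : 0 <= q by exact: powR_ge0.
have q1 : `|q| < 1.
  have -> : 1 = 1 `^ p :> R by rewrite powR1.
  rewrite ger0_norm//.
  by apply: gt0_ltr_powR; rewrite ?inE ?nnegrE//; lra.
apply: (@series_le_cvg R _ (geometric 1 q)) => [n|n|n|].
- exact: powR_ge0.
- by rewrite /= mul1r exprn_ge0.
- rewrite /geometric /= mul1r -powR_mulrn// -powRrM mulrC powRrM.
  rewrite powR_mulrn ?invr_ge0// exprVn.
  have V0 : 0 <= (2 ^+ n)^-1 :> R by rewrite invr_ge0 exprn_ge0.
  apply: ge0_ler_powR; rewrite ?nnegrE ?mulr_ge0 ?normr_ge0 ?(ltW p0)//.
  by rewrite -[leRHS]mul1r ler_wpM2r// T0_le1.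
- exact: is_cvg_geometric_series.
Qed.

Definition is_max_on {T : Type} {R : realType} (f : T -> R) (A : set T) (m : R)
  : Prop := (f @` A) m /\ ubound (f @` A) m.

(* Main.v *)
Require Import Defs.
From mathcomp Require Import all_boot all_order all_algebra.
From mathcomp Require Import all_classical all_reals all_analysis.
From mathcomp Require Import ring lra zify.
Import Order.TTheory GRing.Theory Num.Theory.
Import numFieldNormedType.Exports.
Local Open Scope classical_set_scope.
Local Open Scope ring_scope.

(* Put a_n = T0 (2^n x) and t = 2^-p, so that S_p(x) = sum t^n a_n^p with
   1/2 <= t < 1.  By concavity a^p lies below its tangent line at a = 1/3,
   strictly for a != 1/3, which reduces everything to the linear inequality
   sum t^n (a_n - 1/3) <= 0.  If a_n > 1/3 then
   a_(n+1) - 1/3 = -2 (a_n - 1/3), so the n-th and (n+1)-st terms add up to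
   t^n (1 - 2 t) (a_n - 1/3) <= 0, while the remaining terms are nonpositive.
   Equality forces a_0 = 1/3; conversely a_0 = 1/3 gives a_n = 1/3 for all n. *)

Lemma T0_ge0 (R : realType) (x : R) : 0 <= T0 x.
Proof. exact: normr_ge0. Qed.

Lemma T0_le_half (R : realType) (x : R) : T0 x <= 1 / 2.
Proof.
rewrite /T0; set k := Num.floor _.
have k1 : k%:~R <= x + 1 / 2 by exact: floor_le.
have k2 : x + 1 / 2 < k%:~R + 1 by rewrite -intrD1; exact: floorD1_gt.
by rewrite ler_norml; lra.
Qed.

Lemma T0_eq_dist (R : realType) (x : R) (m : int) :
  `|x - m%:~R| < 1 / 2 -> T0 x = `|x - m%:~R|.
Proof.
rewrite ltr_norml => /andP[h1 h2]; rewrite /T0 (@floor_def _ _ m)// intrD1.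
by apply/andP; split; lra.
Qed.

(** With [k] the integer nearest to [x], the odd integer [2 * k + 1] or [2 * k - 1] on the same side
    as [x] is at distance exactly [1 - 2 * T0 x] from [2 * x]. *)
Lemma T0_double_le (R : realType) (x : R) : T0 (2 * x) <= 1 - 2 * T0 x.
Proof.
have := T0_le_half _ x; rewrite {1 3}/T0; set k := Num.floor _ => h.
have [kx|xk] := lerP 0 (x - k%:~R).
- move: h; rewrite ger0_norm// => h.
  apply: le_trans (T0_le_dist _ (2 * k + 1)) _.
  rewrite intrD intrM /= ler0_norm; lra.
- move: h; rewrite ltr0_norm// => h.
  apply: le_trans (T0_le_dist _ (2 * k - 1)) _.
  rewrite intrB intrM /= ger0_norm; lra.
Qed.

(** Here the odd neighbour of [2 * x] is at distance 1/3 < 1/2, hence it is the nearest integer. *)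
Lemma T0_double_third (R : realType) (x : R) :
  T0 x = 1 / 3 -> T0 (2 * x) = 1 / 3.
Proof.
rewrite {1}/T0; set k := Num.floor _.
have [kx|xk] := lerP 0 (x - k%:~R).
- rewrite ger0_norm// => h.
  have e : `|2 * x - (2 * k + 1)%:~R| = 1 / 3.
    by rewrite intrD intrM /= ler0_norm; lra.
  by rewrite (@T0_eq_dist _ _ (2 * k + 1)) e//; lra.
- rewrite ltr0_norm// => h.
  have e : `|2 * x - (2 * k - 1)%:~R| = 1 / 3.
    by rewrite intrB intrM /= ger0_norm; lra.
  by rewrite (@T0_eq_dist _ _ (2 * k - 1)) e//; lra.
Qed.

Lemma T0_pow2_third (R : realType) (x : R) (n : nat) :
  T0 x = 1 / 3 -> T0 (2 ^+ n * x) = 1 / 3.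
Proof.
move=> x3; elim: n => [|n IH]; first by rewrite expr0 mul1r.
by rewrite exprS -mulrA T0_double_third.
Qed.

Lemma T0_third_unit_interval (R : realType) (x : R) : 0 <= x <= 1 ->
  T0 x = 1 / 3 <-> x = 1 / 3 \/ x = 2 / 3.
Proof.
move=> /andP[x0 x1]; split=> [|[->|->]]; last 2 first.
- have e : `|1 / 3 - 0%:~R| = 1 / 3 :> R by rewrite mulr0z ger0_norm; lra.
  by rewrite (@T0_eq_dist _ _ 0) e//; lra.
- have e : `|2 / 3 - 1%:~R| = 1 / 3 :> R by rewrite mulr1z ler0_norm; lra.
  by rewrite (@T0_eq_dist _ _ 1) e//; lra.
rewrite /T0; set k := Num.floor _ => h.
have k0 : -1 < k.
  by rewrite -(ltr_int R) ltNge; apply/negP => kN; move: h; rewrite ger0_norm; lra.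
have k2 : k < 2.
  by rewrite -(ltr_int R) ltNge; apply/negP => kN; move: h; rewrite ler0_norm; lra.
have [k0'|k1] : k = 0 \/ k = 1 by lia.
- by left; move: h; rewrite k0' ger0_norm; lra.
- by right; move: h; rewrite k1 ler0_norm; lra.
Qed.

(** Strict Bernoulli inequality. For [u > 0], the number [A = 1 + p * (u - 1)] is the weighted mean
    of [u] and 1, and [ln y <= y - 1] at [u / A] and [A^-1], with weights [p] and [1 - p], sums to
    [p * ln u < ln A]. *)
Lemma powR_lt_tangent1 (R : realType) (p u : R) :
  0 < p < 1 -> 0 <= u -> u != 1 -> u `^ p < 1 + p * (u - 1).
Proof.
move=> /andP[p0 p1]; rewrite le_eqVlt => /predU1P[<- _|u0 u1].
  by rewrite powR0 ?gt_eqF//; lra.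
have ln_lt (y : R) : 0 < y -> y != 1 -> ln y < y - 1.
  move=> y0 y1; rewrite -ltr_expR lnK ?posrE//.
  have : y - 1 != 0 by rewrite subr_eq0.
  by move=> /expR_gt1Dx; rewrite addrC subrK.
set A := 1 + p * (u - 1).
have A0 : 0 < A by rewrite /A; nra.
have A1 : A^-1 != 1.
  by rewrite invr_eq1 -subr_eq0 /A addrC addKr mulf_eq0 subr_eq0 (gt_eqF p0).
have uA : ln (u / A) <= u / A - 1.
  have : -1 < u / A - 1 by have := divr_gt0 u0 A0; lra.
  by move=> /le_ln1Dx; rewrite addrC subrK.
(* Strictness comes from this term, whose weight [1 - p] is positive. *)
have iA : ln A^-1 < A^-1 - 1 by rewrite ln_lt// invr_gt0.
rewrite -ltr_ln ?posrE ?powR_gt0// ln_powR.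
move: uA iA; rewrite lnM ?posrE ?invr_gt0// lnV ?posrE// => uA iA.
have AA : p * (u / A) + (1 - p) * A^-1 = 1.
  by rewrite /A; field; rewrite /A in A0; rewrite gt_eqF//; lra.
nra.
Qed.

Lemma powR_le_tangent (R : realType) (p a : R) : 0 < p < 1 -> 0 <= a ->
  a `^ p <= (1 / 3) `^ p * (1 + 3 * p * (a - 1 / 3))
    ?= iff (a == 1 / 3).
Proof.
move=> p01 a0.
have -> : a `^ p = (1 / 3) `^ p * (3 * a) `^ p.
  by rewrite -powRM; [congr (_ `^ _); lra|lra|lra].
have c0 : 0 < (1 / 3) `^ p :> R by rewrite powR_gt0//; lra.
have [->|a3] := eqVneq a (1 / 3).
  rewrite subrr mulr0 addr0 mulr1 (_ : 3 * (1 / 3) = 1) ?powR1 ?mulr1; last lra.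
  exact/leif_refl.
apply/leifP; rewrite /= ltr_pM2l//.
have u1 : 3 * a != 1 by apply: contraNneq a3 => u1; apply/eqP; lra.
have := @powR_lt_tangent1 _ _ (3 * a) p01 _ u1; lra.
Qed.

(** A truncated sum may end on an unpaired positive term. The slack [t ^+ n / 3] covers it: for
    [n = 1] that term is at most 1/6, and 1/6 <= [t / 3]. The slack scales correctly when one or two
    leading terms are removed. *)
Lemma sum_T0_sub_third_le (R : realType) (t : R) (n : nat) (x : R) :
  1 / 2 <= t -> \sum_(i < n) t ^+ i * (T0 (2 ^+ i * x) - 1 / 3) <= t ^+ n / 3.
Proof.
move=> t2; elim/ltn_ind: n x => -[_|[_|n IH]] x.
- by rewrite big_ord0; lra.
- by rewrite big_ord1 expr0 expr1 !mul1r; have := T0_le_half _ x; lra.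
have shift m y : \sum_(i < m.+1) t ^+ i * (T0 (2 ^+ i * y) - 1 / 3) =
    (T0 y - 1 / 3) + t * \sum_(i < m) t ^+ i * (T0 (2 ^+ i * (2 * y)) - 1 / 3).
  rewrite big_ord_recl !expr0 !mul1r mulr_sumr; congr (_ + _).
  by apply: eq_bigr => i _; rewrite lift0 !exprS [2 ^+ i * (2 * y)]mulrCA !mulrA.
have [x3|x3] := lerP (T0 x) (1 / 3).
- rewrite shift; have := IH n.+1 (ltnSn _) (2 * x).
  by rewrite (exprS _ n.+1) => h; nra.
- rewrite 2!shift mulrDr addrA.
  have pair : T0 x - 1 / 3 + t * (T0 (2 * x) - 1 / 3) <= 0.
    by have := T0_double_le _ x; nra.
  have := IH n (leqW (leqnn _)) (2 * (2 * x)); set s := \sum_(_ < _) _ => h.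
  have : t * (t * s) <= t * (t * (t ^+ n / 3)).
    by rewrite !ler_wpM2l//; lra.
  by rewrite !exprS; lra.
Qed.

(** The lower bound makes the pair coefficient [1 - 2 * t] nonpositive; the upper one makes the
    geometric series converge. *)
Lemma powR_half_bounds (R : realType) (p : R) :
  0 < p < 1 -> 1 / 2 <= (2^-1 : R) `^ p < 1.
Proof.
move=> /andP[p0 p1]; apply/andP; split.
  by rewrite -[leLHS]powRr1 ?div1r ?ger_powR//; lra.
rewrite [ltRHS](_ : 1 = 1 `^ p); last by rewrite powR1.
by apply: gt0_ltr_powR => //; rewrite ?nnegrE; lra.
Qed.

Lemma Sp_termE (R : realType) (p x : R) (n : nat) :
  Sp_term p x n = T0 (2 ^+ n * x) `^ p * (2^-1 `^ p) ^+ n.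
Proof.
rewrite /Sp_term powRM ?T0_ge0 ?invr_ge0 ?exprn_ge0// -exprVn.
by rewrite -!powR_mulrn ?invr_ge0 ?powR_ge0// -!powRrM [n%:R * p]mulrC.
Qed.

Lemma Sp_third (R : realType) (p x : R) : 0 < p < 1 ->
  T0 x = 1 / 3 -> Sp p x = (1 / 3) `^ p / (1 - 2^-1 `^ p).
Proof.
move=> /powR_half_bounds /andP[t2 t1] x3; apply/cvg_lim => //.
have -> : Sp_term p x = geometric ((1 / 3) `^ p) (2^-1 `^ p).
  by apply/funext => n; rewrite Sp_termE T0_pow2_third.
by apply: cvg_geometric_series; rewrite ger0_norm ?powR_ge0.
Qed.

Lemma Sp_le_third (R : realType) (p x : R) : 0 < p < 1 ->
  Sp p x <= (1 / 3) `^ p / (1 - 2^-1 `^ p) ?= iff (T0 x == 1 / 3).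
Proof.
move=> p01; have [x3|x3] := eqVneq (T0 x) (1 / 3).
  by rewrite Sp_third//; exact/leif_refl.
apply/leifP => /=.
have /andP[p0 p1] := p01.
have := powR_half_bounds _ _ p01; set t := 2^-1 `^ p => /andP[t2 t1].
set c := (1 / 3) `^ p.
have c0 : 0 < c by rewrite powR_gt0//; lra.
(* The loss in the tangent bound at index 0 does not depend on the length of the partial sum, so
   strictness survives the limit. Only nonempty partial sums contain this term. *)
set gap := c * (1 + 3 * p * (T0 x - 1 / 3)) - T0 x `^ p.
have gap0 : 0 < gap.
  by rewrite subr_gt0; have := powR_le_tangent _ _ _ p01 (T0_ge0 _ x);
     rewrite (negbTE x3) => /leifP.
suff : Sp p x <= c / (1 - t) - gap by lra.
apply: limr_le; first exact: is_cvg_Sp.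
exists 1 => // -[//|n] _ /=.
rewrite /series /= big_mkord.
pose F i := c * t ^+ i + 3 * p * c * (t ^+ i * (T0 (2 ^+ i * x) - 1 / 3)).
have le_sum : \sum_(i < n.+1) Sp_term p x i <= \sum_(i < n.+1) F i - gap.
  rewrite !big_ord_recl Sp_termE /F /gap !expr0 !mul1r !mulr1.
  rewrite [leRHS]addrAC; apply: lerD; first by lra.
  apply: ler_sum => i _; rewrite Sp_termE; set a := T0 _.
  have := (powR_le_tangent _ _ _ p01 (T0_ge0 _ (2 ^+ bump 0 i * x))).1.
  rewrite -/a -/c => h.
  apply: le_trans (ler_wpM2r _ h) _; first exact/exprn_ge0/powR_ge0.
  by rewrite -/t; lra.
apply: le_trans le_sum _; rewrite lerD2r /F big_split /= -!mulr_sumr.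
have := sum_T0_sub_third_le _ _ n.+1 x t2; set s := \sum_(_ < _) _ => hs.
have geo : \sum_(i < n.+1) t ^+ i = (1 - t ^+ n.+1) / (1 - t).
  by rewrite -opprB subrX1 -[1 - t]opprB invrN mulrNN mulrAC mulfV ?mul1r// subr_eq0 lt_eqF.
rewrite geo.
have tn : 0 <= t ^+ n.+1 by rewrite exprn_ge0//; lra.
have V1 : 1 <= (1 - t)^-1 by rewrite invf_ge1; lra.
(* The finite geometric sum falls short of [1 / (1 - t)] by [t ^+ n.+1 / (1 - t)]. This missing tail
   absorbs the slack, as [3 * p * s <= p * t ^+ n.+1] and [p < 1]. *)
suff : c * (3 * p * s) <= c * (t ^+ n.+1 / (1 - t)) by lra.
apply/ler_wpM2l; first exact: ltW.
apply: le_trans (ler_peMr tn V1).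
have : p * s <= p * (t ^+ n.+1 / 3) by rewrite ler_wpM2l// ltW.
nra.
Qed.

Theorem theorem4 (R : realType) (p : R) (p0 : 0 < p) (p1 : p < 1) :
  [/\ [set x : R | `[0, 1]%classic x /\ is_max_on (Sp p) `[0, 1] (Sp p x)]
        = [set 1 / 3; 2 / 3],
      is_max_on (Sp p) `[0, 1] (Sp p (1 / 3))
    & Sp p (1 / 3) = 2 `^ p / (6 `^ p - 3 `^ p)].
Proof.
have p01 : 0 < p < 1 by rewrite p0.
have third01 : `[0, 1]%classic (1 / 3 : R) by rewrite /= in_itv /=; lra.
have T3 : T0 (1 / 3 : R) = 1 / 3.
  by apply/(T0_third_unit_interval _ _ _).2; [lra|left].
have max_third (x : R) : `[0, 1]%classic x -> T0 x = 1 / 3 ->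
    is_max_on (Sp p) `[0, 1] (Sp p x).
  move=> x01 x3; split=> [|_ [y _ <-]]; first by exists x.
  by rewrite (Sp_third _ _ x p01 x3); exact: (Sp_le_third _ _ _ p01).1.
split; last 2 first.
- exact: max_third.
- rewrite (Sp_third _ _ _ p01 T3) div1r.
  have /andP[_] := powR_half_bounds _ _ p01.
  have V y : 0 < y -> y^-1 `^ p = (y `^ p)^-1 :> R.
    by move=> y0; rewrite -[y^-1]powR_inv1 ?ltW// -powRrM mulN1r powRN.
  rewrite !V//.
  have -> : 6 = 2 * 3 :> R by lra.
  rewrite powRM//.
  have : 0 < 2 `^ p :> R by rewrite powR_gt0.
  have : 0 < 3 `^ p :> R by rewrite powR_gt0.
  (* The bound [a > 1] keeps the denominators [1 - a^-1] and [a * b - b] nonzero. *)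
  move: (2 `^ p) (3 `^ p) => a b b0 a0; rewrite invf_lt1// => a1.
  field; rewrite ?gt_eqF//; nra.
- apply/seteqP; split=> [x [x01 [_ xmax]]|x x3].
    have xI : 0 <= x <= 1 by move: x01; rewrite /= in_itv.
    apply/(T0_third_unit_interval _ _ xI).1/eqP.
    (* A maximizer does at least as well as 1/3, so it reaches the upper bound, and the equality
       case applies. *)
    rewrite -(Sp_le_third _ p x p01).2 eq_le (Sp_le_third _ p x p01).1 /=.
    by rewrite -(Sp_third _ _ _ p01 T3); apply: xmax; exists (1 / 3).
  have xI : 0 <= x <= 1 by case: x3 => ->; apply/andP; split; lra.
  have x01 : `[0, 1]%classic x by rewrite /= in_itv.
  by split=> //; apply: max_third => //; exact/(T0_third_unit_interval _ _ xI).2.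
Qed.
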